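(* Suppose all customers have unit utility ($u_k=1$ for all $k\in\mathcal N$) and assume $0\le\theta<\frac\pi2$ and $0\le\theta_{\rm zs}<\frac\pi2$. Then: (1) $\textsc{GreedyAlloc}_{\sf C}$ is an $\alpha$-approximation for $\textsc{sMaxOPF}_{\sf C}$, where $\alpha=\big(\lfloor\sec\theta\cdot\sec\tfrac\theta2\rfloor+1\big)^{-1}$; (2) $\textsc{GreedyAlloc}_{\sf V}$ is an $\alpha$-approximation for $\textsc{sMaxOPF}_{\sf V}$, where $\alpha=\big(\lfloor\eta\cdot\rho\cdot\sec\theta_{\rm zs}\rfloor+1\big)^{-1}$; (3) $\textsc{GreedyAlloc}$ is an $\alpha$-approximation for $\textsc{sMaxOPF}$, where $\alpha=\big(\lfloor\eta\cdot\rho\cdot\sec\theta_{\rm zs}\rfloor+\lfloor\sec\theta\cdot\sec\tfrac\theta2\rfloor+2\big)^{-1}$.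
   Context: Rooted tree $\mathcal G=(\mathcal V,\mathcal E)$ with root $0$; each edge $e$ has impedance $z_e\in\mathbb C$ with $z_e^{\rm R}=\mathrm{Re}(z_e)>0$, $z_e^{\rm I}=\mathrm{Im}(z_e)>0$. Customers $\mathcal N$ ($n=|\mathcal N|$) are attached to non-root nodes; customer $k$ has inelastic demand $s_k\in\mathbb C$ (real/imaginary parts $s_k^{\rm R},s_k^{\rm I}$), utility $u_k$, and decision $x_k\in\{0,1\}$. For an edge $e$, $P_e$ is the set of edges on the path from $e$ (inclusive) to the root; for a customer $k$ at node $j$, $P_k$ is the set of edges on the path from $j$ to the root. Given are nonnegative reals $\hat C_e$ ($e\in\mathcal E$) and a real number $\overline V$. Constraints: (C) $\big|\sum_{k:e\in P_k}s_kx_k\big|\le\hat C_e$ for all $e\in\mathcal E$; (V) $\sum_{k\in\mathcal N}\big(\sum_{e'\in P_k\cap P_e}(z^{\rm R}_{e'}s_k^{\rm R}+z^{\rm I}_{e'}s_k^{\rm I})\big)x_k\le\overline V$ for all $e\in\mathcal E$. $\textsc{sMaxOPF}$ maximizes $\sum_ku_kx_k$ over $x\in\{0,1\}^{\mathcal N}$ subject to (C) and (V); $\textsc{sMaxOPF}_{\sf C}$ uses only (C); $\textsc{sMaxOPF}_{\sf V}$ uses only (V). $\textsc{GreedyAlloc}$ (resp. $\textsc{GreedyAlloc}_{\sf C}$, $\textsc{GreedyAlloc}_{\sf V}$): sort customers so that $|s_1|\le|s_2|\le\cdots$; start with $M=\varnothing$; for each customer $k$ in this order, add $k$ to $M$ if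 setting $x_{k'}=1$ exactly for $k'\in M\cup\{k\}$ satisfies the constraints of $\textsc{sMaxOPF}$ (resp. $\textsc{sMaxOPF}_{\sf C}$, $\textsc{sMaxOPF}_{\sf V}$); output $M$. An $\alpha$-approximation outputs a feasible solution of utility at least $\alpha$ times the optimum. Parameters: $\theta=\max_{k,k'\in\mathcal N}|\arg(s_k)-\arg(s_{k'})|$; $\theta_{\rm zs}=\max_{k\in\mathcal N,e\in P_k}|\arg(s_k)-\arg(z_e)|$; $\eta=\max_{e\in\mathcal E}|P_e|$; $\rho=\max_{\tilde e\in\mathcal E}\max_{e,e'\in P_{\tilde e}}|z_e|/|z_{e'}|$. *)

(* Defs.v *)
From HB Require Import structures.
From mathcomp Require Import all_boot all_order all_algebra.
From mathcomp Require Import complex.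
From mathcomp Require Import boolp reals trigo.

Set Implicit Arguments.
Unset Strict Implicit.
Unset Printing Implicit Defensive.

Import Order.TTheory GRing.Theory Num.Theory.
Local Open Scope ring_scope.

Section ComplexAndTrig.
Variable R : realType.

(* R-valued modulus; the generic `|z| takes values in R[i]. *)
Definition cmod (z : R[i]) : R := ComplexField.Normc.normc z.

(* Principal argument, in ]-pi, pi], with the convention carg 0 = 0. *)
Definition carg (z : R[i]) : R :=
  if z == 0 then 0
  else if 0 <= complex.Im z then acos (complex.Re z / cmod z)
  else - acos (complex.Re z / cmod z).

Definition sec (x : R) : R := (cos x)^-1.

End ComplexAndTrig.

Section Graph.
Variables (V : finType) (E : {set {set V}}).

Definition adj : rel V := fun v w => [set v; w] \in E.

Definition simple_graph : Prop := forall e, e \in E -> #|e| = 2%N.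

Definition connected_graph : Prop := forall v w, connect adj v w.

Definition acyclic : Prop := forall c : seq V, ucycle adj c -> (size c <= 2)%N.

Definition tree : Prop := [/\ simple_graph, connected_graph & acyclic].

Definition edges_on (v : V) (p : seq V) : seq {set V} :=
  pairmap (fun x y => [set x; y]) v p.

Definition simple_path_to (r v : V) (p : seq V) : Prop :=
  [/\ path adj v p, uniq (v :: p) & last v p = r].

(* In a tree the path p below exists and is unique. *)
Definition node_path (r v : V) : {set {set V}} :=
  [set f | `[< exists2 p, simple_path_to r v p & f \in edges_on v p >] ].

(* The path from the edge e (inclusive) to r is the simple path ending at r
   whose first edge is e. *)
Definition edge_path (r : V) (e : {set V}) : {set {set V}} :=
  [set f | `[< exists v w p, [/\ e = [set v; w], simple_path_to r v (w :: p)
                               & f \in edges_on v (w :: p)] >] ].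

End Graph.

Record opf_instance (R : realType) := OpfInstance {
  node : finType;
  edges : {set {set node}};
  root : node;
  treeP : tree edges;
  impedance : {set node} -> R[i];
  impedance_Re_gt0 : forall e, e \in edges -> 0 < complex.Re (impedance e);
  impedance_Im_gt0 : forall e, e \in edges -> 0 < complex.Im (impedance e);
  customer : finType;
  location : customer -> node;
  location_neq_root : forall k, location k != root;
  demand : customer -> R[i];
  utility : customer -> R;
  capacity : {set node} -> R;
  capacity_ge0 : forall e, e \in edges -> 0 <= capacity e;
  Vbar : R
}.

Section Problem.
Variables (R : realType) (I : opf_instance R).

Local Notation E := (edges I).
Local Notation z := (@impedance R I).
Local Notation s := (@demand R I).

Definition Pe (e : {set node I}) : {set {set node I}} :=
  edge_path E (root I) e.

Definition Pk (k : customer I) : {set {set node I}} :=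
  node_path E (root I) (location k).

Definition decision := {ffun customer I -> bool}.

Definition constraintC : pred decision := fun x =>
  [forall e in E,
     cmod (\sum_(k | e \in Pk k) s k * (x k)%:R) <= capacity e].

Definition constraintV : pred decision := fun x =>
  [forall e in E,
     \sum_k (\sum_(e' in Pk k :&: Pe e)
               (complex.Re (z e') * complex.Re (s k)
                + complex.Im (z e') * complex.Im (s k))) * (x k)%:R
     <= Vbar I].

Definition constraintCV : pred decision :=
  fun x => constraintC x && constraintV x.

Definition total_utility (x : decision) : R :=
  \sum_k utility k * (x k)%:R.

Definition optimal (feas : pred decision) (x : decision) : Prop :=
  feas x /\ forall y, feas y -> total_utility y <= total_utility x.

(* On an instance without feasible points (possible when Vbar < 0) there is no
   optimum, and nothing is asked of the output. *)
Definition approximation (alpha : R) (feas : pred decision) (x : decision) :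
  Prop :=
  forall opt, optimal feas opt ->
    feas x /\ alpha * total_utility opt <= total_utility x.

Definition indicator (M : {set customer I}) : decision := [ffun k => k \in M].

(* Ties may be broken arbitrarily. *)
Definition greedy_order (o : seq (customer I)) : Prop :=
  perm_eq o (enum (customer I)) /\
  sorted (fun k k' => cmod (s k) <= cmod (s k')) o.

Definition greedy (feas : pred decision) (o : seq (customer I)) :
  {set customer I} :=
  foldl (fun M k => if feas (indicator (k |: M)) then k |: M else M) set0 o.

Definition GreedyAllocC o : decision := indicator (greedy constraintC o).
Definition GreedyAllocV o : decision := indicator (greedy constraintV o).
Definition GreedyAlloc o : decision := indicator (greedy constraintCV o).

(* All quantities maximized below are nonnegative, so the default value 0 only
   matters for an empty index range. *)
Definition theta : R :=
  \big[Num.max/0]_(k : customer I) \big[Num.max/0]_(k' : customer I)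
    `|carg (s k) - carg (s k')|.

Definition theta_zs : R :=
  \big[Num.max/0]_(k : customer I) \big[Num.max/0]_(e in Pk k)
    `|carg (s k) - carg (z e)|.

Definition eta : nat := \max_(e in E) #|Pe e|.

Definition rho : R :=
  \big[Num.max/0]_(e0 in E) \big[Num.max/0]_(e in Pe e0)
    \big[Num.max/0]_(e' in Pe e0) (cmod (z e) / cmod (z e')).

End Problem.

(* Main.v *)
Require Import Defs.
From mathcomp Require Import all_boot all_order all_algebra.
From mathcomp Require Import complex.
From mathcomp Require Import boolp reals trigo.
From mathcomp Require Import ring lra.

(** Sort the customers by [|s_k|] and call a family of feasible sets extendible
    with constant [n] when a customer that the greedy algorithm accepts can be
    added to any larger feasible set at the price of at most [n] deletions among
    the later customers. Following an optimal solution along the run of the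
    algorithm then shows [|OPT| <= n |GREEDY|].

    If [k] joins a feasible set and [J] is an inclusion-minimal set of deletions
    restoring feasibility, putting back any single [j] in [J] violates a
    constraint to which both [k] and [j] contribute; call [e] the edge of that
    constraint.

    For (C), all these edges lie on the path of [k]; the one closest to the root
    is crossed by all of [J]. At least [sec theta] vectors no shorter than [s_k],
    in a cone of angle [theta], outweigh [s_k], so [|J| - 1 < sec theta].

    For (V), the edge [f] at the root on the path of [k] is shared by all of [J].
    At [e] customer [k] causes a drop of at most [eta rho |z_f| |s_k|], and each
    [j] in [J] one of at least [|z_f| |s_k| cos theta_zs], so
    [|J| - 1 < eta rho sec theta_zs].

    For both constraints together, the extendibility constants add up. *)

Set Implicit Arguments.
Unset Strict Implicit.
Unset Printing Implicit Defensive.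

Import Order.TTheory GRing.Theory Num.Theory.
Local Open Scope ring_scope.

Section IndependenceSystem.
Variable T : finType.
Implicit Types (feas : pred {set T}) (A B M O J : {set T}) (le : rel T).

Definition hereditary feas : Prop :=
  forall A B, A \subset B -> feas B -> feas A.

(* Mestre's extendible systems, except that the exchange is required only when
   [k] precedes all of [O :\: M]. *)
Definition extendible feas le (n : nat) : Prop :=
  forall M O k, M \subset O -> feas O -> k \notin O -> feas (k |: M) ->
    {in O :\: M, forall j, le k j} ->
  exists J, [/\ J \subset O :\: M, (#|J| <= n)%N & feas (k |: (O :\: J))].

Fixpoint greedy_extend feas M (o : seq T) : {set T} :=
  if o is k :: o' then greedy_extend feas (if feas (k |: M) then k |: M else M) o'
  else M.

Definition blocks feas J A k : Prop :=
  [/\ k \notin J :|: A, [disjoint J & A], feas (J :|: A), feas (k |: A)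
    & {in J, forall j, ~~ feas (k |: (j |: A))}].

Lemma hereditaryI feas1 feas2 :
  hereditary feas1 -> hereditary feas2 -> hereditary (predI feas1 feas2).
Proof.
move=> her1 her2 A B sAB /andP[fB1 fB2].
by rewrite /= (her1 _ _ sAB fB1) (her2 _ _ sAB fB2).
Qed.

Lemma extendibleI feas1 feas2 le n1 n2 :
  hereditary feas1 -> hereditary feas2 ->
  extendible feas1 le n1 -> extendible feas2 le n2 ->
  extendible (predI feas1 feas2) le (n1 + n2).
Proof.
move=> her1 her2 ext1 ext2 M O k sMO /andP[fO1 fO2] kO /andP[fk1 fk2] lek.
have [J1 [sJ1 cJ1 fJ1]] := ext1 _ _ _ sMO fO1 kO fk1 lek.
have [J2 [sJ2 cJ2 fJ2]] := ext2 _ _ _ sMO fO2 kO fk2 lek.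
exists (J1 :|: J2); split; first by rewrite subUset sJ1.
  by rewrite (leq_trans _ (leq_add cJ1 cJ2)) // cardsU leq_subr.
apply/andP; split; [apply: her1 fJ1 | apply: her2 fJ2];
  by rewrite setUS // setDS // (subsetUl, subsetUr).
Qed.

Lemma extendible_of_blocks feas le n :
  (forall J A k, blocks feas J A k -> {in J, forall j, le k j} -> (#|J| <= n)%N) ->
  extendible feas le n.
Proof.
move=> bound M O k sMO fO kO fkM lek.
have fkOM : feas (k |: (O :\: (O :\: M))).
  by rewrite setDDr setDv set0U (setIidPr sMO).
have [J /minsetP[fJ Jmin] sJ] :=
  @minset_exists _ [pred J | feas (k |: (O :\: J))] _ fkOM.
have sJO : J \subset O := subset_trans sJ (subsetDl O M).
exists J; split=> //; apply: (bound J (O :\: J) k); last by move=> j /(subsetP sJ)/lek.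
have JO : J :|: (O :\: J) = O by rewrite setDE setUIr setUCr setIT; apply/setUidPr.
split; rewrite ?JO //; first by rewrite disjoint_sym disjoints_subset setDE subsetIr.
move=> j jJ.
have -> : j |: (O :\: J) = O :\: (J :\ j).
  by rewrite setDDr setUC (setIidPr _) // sub1set (subsetP sJO).
apply/negP => /Jmin /(_ (subsetDl _ _)) JE.
by move: jJ; rewrite -JE !inE eqxx.
Qed.

End IndependenceSystem.

Lemma setDU1 (T : finType) (A B : {set T}) (k : T) : A :\: (k |: B) = (A :\: B) :\ k.
Proof. by rewrite setUC setDDl. Qed.

Section GreedyBound.
Variables (T : finType) (feas : pred {set T}) (le : rel T) (n : nat).
Hypotheses (feas_hereditary : hereditary feas) (le_refl : reflexive le).
Hypotheses (n_gt0 : (0 < n)%N) (feas_extendible : extendible feas le n).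
Implicit Types (M O : {set T}) (o : seq T).

Lemma greedy_extend_feasible M o : feas M -> feas (greedy_extend feas M o).
Proof. by elim: o M => //= k o IH M fM; apply: IH; case: ifP. Qed.

Lemma sub_greedy_extend M o : M \subset greedy_extend feas M o.
Proof.
elim: o M => //= k o IH M; apply: subset_trans (IH _).
by case: ifP => // _; apply: subsetUr.
Qed.

Lemma greedy_exchange M O k : M \subset O -> feas O -> feas (k |: M) ->
    {in O :\: M, forall j, le k j} ->
  exists O', [/\ k |: M \subset O', feas O', O' :\: (k |: M) \subset (O :\: M) :\ k
    & (#|O :\: M| <= #|O' :\: (k |: M)| + n)%N].
Proof.
move=> sMO fO fkM lek; have [kO|kO] := boolP (k \in O).
  exists O; rewrite setDU1; split; rewrite ?subUset ?sub1set ?kO //.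
  rewrite (cardsD1 k (O :\: M)) addnC leq_add2l.
  exact: leq_trans (leq_b1 _) n_gt0.
have [J [/subsetP sJ cJ fJ]] := feas_extendible sMO fO kO fkM lek.
have sJM : M \subset O :\: J.
  apply/subsetP => x xM; rewrite inE (subsetP sMO) // andbT.
  by apply/negP => /sJ; rewrite inE xM.
exists (k |: (O :\: J)); split=> //; first exact: setUS.
  apply/subsetP => x; rewrite !inE negb_or => /andP[/andP[/negbTE -> ->]] /=.
  by case/andP.
apply: leq_trans (_ : #|((k |: (O :\: J)) :\: (k |: M)) :|: J| <= _)%N.
  apply/subset_leq_card/subsetP => x /setDP[xO xM].
  have xk : x != k by apply: contraNneq kO => <-.
  by rewrite !inE xO (negbTE xM) (negbTE xk) /= andbT orNb.
by apply: leq_trans (leq_card_setU _ _) _; rewrite leq_add2l.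
Qed.

Lemma greedy_extend_card o M O :
  M \subset O -> feas O -> pairwise le o -> {subset O :\: M <= o} ->
  (#|O :\: M| <= n * #|greedy_extend feas M o :\: M|)%N.
Proof.
elim: o M O => [|k o IH] M O sMO fO /= => [_ sub|/andP[/allP ltk po] sub].
  suff -> : O :\: M = set0 by rewrite cards0.
  by apply/setP => x; rewrite [RHS]inE; apply/negP => /sub.
have skip : k \notin O :\: M -> (#|O :\: M| <= n * #|greedy_extend feas M o :\: M|)%N.
  move=> kOM; apply: IH => // x xOM; have := sub x xOM.
  by rewrite inE => /predU1P[xk|//]; rewrite -xk xOM in kOM.
have [kM|kM] := boolP (k \in M).
  by rewrite (setUidPr _) ?sub1set // if_same skip // inE kM.
case: ifP => fkM; last first.
  apply: skip; apply/negP => /setDP[kO _]; move: fkM.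
  by rewrite (feas_hereditary _ fO) // subUset sub1set kO.
have lek : {in O :\: M, forall j, le k j}.
  by move=> j /sub; rewrite inE => /predU1P[->|/ltk].
have [O' [sMO' fO' sO' cO']] := greedy_exchange sMO fO fkM lek.
have kG : k \in greedy_extend feas (k |: M) o :\: M.
  by rewrite inE kM (subsetP (sub_greedy_extend _ _)) ?setU11.
rewrite (cardsD1 k (greedy_extend _ _ _ :\: M)) kG mulnDr muln1 addnC -setDU1.
apply: leq_trans cO' _; rewrite leq_add2r.
apply: IH => // x /(subsetP sO') /setD1P[xk /sub].
by rewrite inE (negbTE xk).
Qed.

Lemma greedy_card o O : feas O -> pairwise le o -> {subset O <= o} ->
  (#|O| <= n * #|greedy_extend feas set0 o|)%N.
Proof.
move=> fO po sO.
by have := @greedy_extend_card o set0 O; rewrite !setD0; apply; rewrite ?sub0set.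
Qed.

End GreedyBound.

Section BudgetConstraints.
Variables (R : realDomainType) (T X : finType) (E : {set X}) (U : nmodType).
Variables (magnitude : U -> R) (load : T -> X -> U) (budget : X -> R).
Implicit Types (A B J : {set T}) (e : X).

Definition total_load A e : U := \sum_(k in A) load k e.

Definition within_budget : pred {set T} :=
  fun A => [forall e in E, magnitude (total_load A e) <= budget e].

Definition overloaded A e : bool :=
  (e \in E) && (budget e < magnitude (total_load A e)).

Lemma within_budget_hereditary :
  (forall A B e, A \subset B ->
     magnitude (total_load A e) <= magnitude (total_load B e)) ->
  hereditary within_budget.
Proof.
move=> mono A B sAB /forall_inP wB; apply/forall_inP => e eE.
exact: le_trans (mono _ _ e sAB) (wB e eE).
Qed.

Lemma total_loadU A B e : [disjoint A & B] ->
  total_load (A :|: B) e = total_load A e + total_load B e.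
Proof.
by move=> dAB; rewrite /total_load -bigU //; apply: eq_bigl => k; rewrite inE.
Qed.

Lemma total_loadU1 A e k : k \notin A ->
  total_load (k |: A) e = load k e + total_load A e.
Proof. exact: big_setU1. Qed.

Lemma blocks_overloaded J A k j : blocks within_budget J A k -> j \in J ->
  exists e, overloaded (k |: (j |: A)) e.
Proof.
move=> [_ _ _ _ noJ] /noJ /forall_inPn[e eE viol].
by exists e; rewrite /overloaded eE ltNge.
Qed.

Lemma overloaded_load_neq0 A k e :
  within_budget A -> overloaded (k |: A) e -> load k e != 0.
Proof.
move=> /forall_inP wA /andP[eE]; apply: contraTneq => load0.
have [kA|kA] := boolP (k \in A); first by rewrite (setUidPr _) ?sub1set // -leNgt wA.
by rewrite total_loadU1 // load0 add0r -leNgt wA.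
Qed.

Hypothesis budget_hereditary : hereditary within_budget.

Lemma blocks_load_neq0 J A k j e : blocks within_budget J A k -> j \in J ->
  overloaded (k |: (j |: A)) e -> load k e != 0 /\ load j e != 0.
Proof.
move=> [_ _ wJA wkA _] jJ over; split; last first.
  by apply: overloaded_load_neq0 wkA _; rewrite setUCA.
apply: overloaded_load_neq0 over; apply: budget_hereditary wJA.
by rewrite setSU // sub1set.
Qed.

Lemma blocks_magnitude_lt J A k j e : blocks within_budget J A k -> j \in J ->
    overloaded (k |: (j |: A)) e ->
  magnitude (total_load (J :\ j) e + total_load (j |: A) e)
    < magnitude (load k e + total_load (j |: A) e).
Proof.
move=> [kJA dJA /forall_inP wJA _ _] jJ /andP[eE].
have kjA : k \notin j |: A.
  by apply: contra kJA => /setU1P[->|kA]; rewrite inE ?jJ ?kA ?orbT.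
have djA : [disjoint J :\ j & j |: A].
  rewrite disjoints_subset; apply/subsetP => i /setD1P[ij iJ].
  by rewrite !inE negb_or ij (disjointFr dJA iJ).
have JA : J :|: A = (J :\ j) :|: (j |: A).
  by rewrite setUA [_ :|: [set j]]setUC setD1K.
by rewrite total_loadU1 // -total_loadU // -JA; apply/le_lt_trans/wJA.
Qed.

End BudgetConstraints.

Section RootedTree.
Variables (V : finType) (E : {set {set V}}) (r : V).
Hypothesis treeE : tree E.
Implicit Types (v w : V) (p q : seq V) (e f g : {set V}).

Definition parent v w : Prop := exists p, simple_path_to E r v (w :: p).

Lemma adj_sym : symmetric (adj E).
Proof. by move=> v w; rewrite /adj setUC. Qed.

Lemma simple_path_cons v w p :
  simple_path_to E r v (w :: p) -> simple_path_to E r w p.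
Proof. by case=> /= /andP[_ ?] /andP[_ ?] ?; split. Qed.

Lemma simple_path_exists v : exists p, simple_path_to E r v p.
Proof.
have [_ connE _] := treeE; case/connectP: (connE v r) => p pp lp.
by case: (shortenP pp) lp => q pq uq _ lq; exists q; split.
Qed.

Lemma simple_path_root p : simple_path_to E r r p -> p = [::].
Proof. by case: p => // w p [_ /= /andP[+ _]] lp; rewrite -{1}lp mem_last. Qed.

(* Otherwise the path and the two edges to [v] would form a cycle. *)
Lemma acyclic_neighbor_path v w p : adj E v w -> adj E v (last w p) ->
  path (adj E) w p -> v \notin w :: p -> last w p = w.
Proof.
have [_ _ acyE] := treeE.
move=> avw + pp; case: (shortenP pp) => q pq uq sq avl vp.
have /acyE : ucycle (adj E) (v :: w :: q).
  rewrite /ucycle /= avw rcons_path pq adj_sym avl /= -/(uniq (w :: q)) uq andbT.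
  by apply: contra vp; rewrite !inE => /orP[->//|/sq ->]; rewrite orbT.
by case: q {pq uq sq avl}.
Qed.

Lemma simple_path_step_unique v w w' p q :
  simple_path_to E r v (w :: p) -> simple_path_to E r v (w' :: q) -> w = w'.
Proof.
case=> /= /andP[avw pp] /andP[vp _] lp [/= /andP[avw' pq] /andP[vq _] lq].
have pc : path (adj E) w (p ++ rev (belast w' q)).
  rewrite cat_path pp lp -lq rev_path.
  by rewrite (eq_path (e' := adj E)) // => x y; rewrite /= adj_sym.
have lc : last w (p ++ rev (belast w' q)) = w'.
  rewrite last_cat; case: (q) lq => [|x q'] /=; first by rewrite lp.
  by rewrite rev_cons last_rcons.
rewrite -lc; apply/esym/(acyclic_neighbor_path avw _ pc); rewrite ?lc //.
rewrite -cat_cons mem_cat negb_or vp mem_rev.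
by apply: contra vq => /mem_belast.
Qed.

Lemma simple_path_unique v p q :
  simple_path_to E r v p -> simple_path_to E r v q -> p = q.
Proof.
elim: p v q => [|w p IH] v q Pp Pq.
  by case: (Pp) => _ _ /= vr; rewrite vr in Pq; rewrite (simple_path_root Pq).
case: q Pq => [|w' q] Pq.
  by case: (Pq) => _ _ /= vr; rewrite vr in Pp; apply: simple_path_root Pp.
have ww' := simple_path_step_unique Pp Pq; rewrite -{}ww' in Pq *.
by congr cons; apply: IH (simple_path_cons Pp) (simple_path_cons Pq).
Qed.

Lemma in_node_path v p f :
  simple_path_to E r v p -> (f \in node_path E r v) = (f \in edges_on v p).
Proof.
move=> Pp; rewrite inE; apply/asboolP/idP => [[q Pq]|]; last by exists p.
by rewrite (simple_path_unique Pq Pp).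
Qed.

Lemma node_path_root : node_path E r r = set0.
Proof. by apply/setP => f; rewrite (@in_node_path _ [::]) ?inE. Qed.

Lemma parent_neq_root v w : parent v w -> v != r.
Proof.
by case=> p Pp; apply/eqP => vr; rewrite vr in Pp; have := simple_path_root Pp.
Qed.

Lemma parent_edge v w : parent v w -> [set v; w] \in E.
Proof. by case=> p [/= /andP[]]. Qed.

Lemma node_path_parent v w :
  parent v w -> node_path E r v = [set v; w] |: node_path E r w.
Proof.
case=> p Pp; apply/setP => f.
by rewrite (in_node_path _ Pp) in_setU1 (in_node_path _ (simple_path_cons Pp)).
Qed.

Lemma parent_asym v w : parent v w -> ~ parent w v.
Proof.
move=> [p Pp] [q Pq]; have pE := simple_path_unique (simple_path_cons Pp) Pq.
by case: Pp => _ /=; rewrite pE !inE eqxx orbT.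
Qed.

Lemma edge_path_parent v w :
  parent v w -> edge_path E r [set v; w] = node_path E r v.
Proof.
move=> par; have [p Pp] := par; apply/setP => f; rewrite (in_node_path _ Pp) inE.
apply/asboolP/idP => [[v' [w' [q [vwE Pq fq]]]]|]; last by exists v, w, p.
have [v'v|v'v] := eqVneq v' v.
  by subst v'; rewrite (simple_path_unique Pp Pq).
have v'w : v' = w.
  by apply/eqP; have := set21 v' w'; rewrite -vwE !inE (negbTE v'v).
have w'v : w' = v.
  by apply/eqP; have := set21 v w; rewrite vwE !inE eq_sym (negbTE v'v) eq_sym.
by subst v' w'; case: (parent_asym par); exists q.
Qed.

Lemma rooted_tree_ind (P : V -> Prop) :
  P r -> (forall v w, parent v w -> P w -> P v) -> forall v, P v.
Proof.
move=> Pr Pparent v; have [p Pp] := simple_path_exists v.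
elim: p v Pp => [|w p IH] v Pp; first by case: Pp => _ _ /= ->.
by apply: (Pparent v w); [exists p | apply: IH (simple_path_cons Pp)].
Qed.

Lemma node_path_sub v : node_path E r v \subset E.
Proof.
elim/rooted_tree_ind: v => [|v w vw IH]; first by rewrite node_path_root sub0set.
by rewrite (node_path_parent vw) subUset sub1set (parent_edge vw).
Qed.

Lemma edge_path_node_path e f : f \in edge_path E r e ->
  exists2 v, v != r & edge_path E r e = node_path E r v.
Proof.
rewrite inE => /asboolP[v [w [p [-> Pp _]]]].
have vw : parent v w by exists p.
by exists v; [apply: parent_neq_root vw | apply: edge_path_parent].
Qed.

Lemma edge_path_sub e : edge_path E r e \subset E.
Proof.
apply/subsetP => f fe; have [v _ eE] := edge_path_node_path fe.
by move: fe; rewrite eE; apply/subsetP/node_path_sub.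
Qed.

Lemma mem_edge_path v f : f \in node_path E r v -> f \in edge_path E r f.
Proof.
elim/rooted_tree_ind: v => [|v w vw IH]; first by rewrite node_path_root inE.
rewrite (node_path_parent vw) => /setU1P[->|/IH//].
by rewrite (edge_path_parent vw) (node_path_parent vw) setU11.
Qed.

Lemma edge_path_sub_node_path v f :
  f \in node_path E r v -> edge_path E r f \subset node_path E r v.
Proof.
elim/rooted_tree_ind: v => [|v w vw IH]; first by rewrite node_path_root inE.
rewrite (node_path_parent vw) => /setU1P[->|/IH sub].
  by rewrite (edge_path_parent vw) (node_path_parent vw).
exact: subset_trans sub (subsetUr _ _).
Qed.

Lemma node_path_closest_edge v (A : {set {set V}}) :
  A != set0 -> A \subset node_path E r v ->
  exists2 f, f \in A & {in A, forall g, f \in edge_path E r g}.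
Proof.
elim/rooted_tree_ind: v A => [|v w vw IH] A A0 sA.
  by rewrite node_path_root subset0 (negbTE A0) in sA.
have upper g : g \in A -> g = [set v; w] \/ g \in A :&: node_path E r w.
  move=> gA; have := subsetP sA g gA; rewrite (node_path_parent vw).
  by case/setU1P => [->|gw]; [left | right; rewrite inE gA].
have [A'0|A'0] := eqVneq (A :&: node_path E r w) set0.
  have Avw g : g \in A -> g = [set v; w] by case/upper=> //; rewrite A'0 inE.
  have /set0Pn[f fA] := A0; exists f => // g gA; rewrite (Avw g) // -(Avw f) //.
  exact: mem_edge_path (subsetP sA f fA).
have [f /setIP[fA fw] fmin] := IH _ A'0 (subsetIr _ _).
exists f => // g /upper[->|/fmin//].
by rewrite (edge_path_parent vw) (node_path_parent vw) inE fw orbT.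
Qed.

Lemma root_edge_exists v : v != r -> exists2 f, f \in node_path E r v & r \in f.
Proof.
elim/rooted_tree_ind: v => [|v w vw IH]; first by rewrite eqxx.
move=> _; rewrite (node_path_parent vw); have [wr|/IH[f fw rf]] := eqVneq w r.
  by exists [set v; w]; [apply: setU11 | rewrite wr set22].
by exists f; first exact: setU1r.
Qed.

Lemma root_edge_unique v f g : f \in node_path E r v -> g \in node_path E r v ->
  r \in f -> r \in g -> f = g.
Proof.
elim/rooted_tree_ind: v => [|v w vw IH]; first by rewrite node_path_root inE.
have rvw : r \in [set v; w] -> w = r.
  by rewrite !inE ![r == _]eq_sym (negbTE (parent_neq_root vw)) => /eqP.
rewrite (node_path_parent vw) => /setU1P[->|fw] /setU1P[->|gw] // rf rg.
- by move: gw; rewrite (rvw rf) node_path_root inE.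
- by move: fw; rewrite (rvw rg) node_path_root inE.
exact: IH.
Qed.

Lemma meeting_paths_root_edge v w f g :
  f \in node_path E r v -> f \in node_path E r w ->
  g \in node_path E r v -> r \in g -> g \in node_path E r w.
Proof.
move=> fv fw gv rg; have [u ur fE] := edge_path_node_path (mem_edge_path fv).
have [h hu rh] := root_edge_exists ur; rewrite -fE in hu.
have hv := subsetP (edge_path_sub_node_path fv) h hu.
rewrite (root_edge_unique gv hv rg rh).
exact: subsetP (edge_path_sub_node_path fw) h hu.
Qed.

End RootedTree.

Section PlaneVectors.
Variable R : realType.
Implicit Types (z w : R[i]) (t : R).

Definition dot z w : R :=
  complex.Re z * complex.Re w + complex.Im z * complex.Im w.

Lemma dotC z w : dot z w = dot w z.
Proof. by rewrite /dot; congr (_ + _); apply: mulrC. Qed.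

Lemma dot0 w : dot 0 w = 0.
Proof. by rewrite /dot /= !mul0r addr0. Qed.

Lemma dotDl z1 z2 w : dot (z1 + z2) w = dot z1 w + dot z2 w.
Proof. by case: z1 => ? ?; case: z2 => ? ?; rewrite /dot /=; ring. Qed.

Lemma dot_suml (T : Type) (r : seq T) (P : pred T) (s : T -> R[i]) w :
  dot (\sum_(i <- r | P i) s i) w = \sum_(i <- r | P i) dot (s i) w.
Proof. exact: (big_morph (dot^~ w) (fun z1 z2 => dotDl z1 z2 w) (dot0 w)). Qed.

Lemma cmod_ge0 z : 0 <= cmod z.
Proof. by case: z => x y; apply: sqrtr_ge0. Qed.

Lemma cmod0 : cmod 0 = 0 :> R.
Proof. exact: ComplexField.Normc.normc0. Qed.

Lemma cmod_gt0 z : (0 < cmod z) = (z != 0).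
Proof.
rewrite lt_def cmod_ge0 andbT; congr (~~ _).
by apply/eqP/eqP => [/ComplexField.Normc.eq0_normc|->]; rewrite ?cmod0.
Qed.

Lemma sqr_cmod z : cmod z ^+ 2 = dot z z.
Proof. by case: z => x y; rewrite sqr_sqrtr ?addr_ge0 ?sqr_ge0. Qed.

Lemma ler_cmod z w : (cmod z <= cmod w) = (dot z z <= dot w w).
Proof. by rewrite -!sqr_cmod ler_sqr ?nnegrE ?cmod_ge0. Qed.

Lemma dot_sqrD z w : dot (z + w) (z + w) = dot z z + 2 * dot z w + dot w w.
Proof. by case: z => ? ?; case: w => ? ?; rewrite /dot /=; ring. Qed.

Lemma Re_div_cmod_bounds z : -1 <= complex.Re z / cmod z <= 1.
Proof.
rewrite -ler_norml normrM normfV (ger0_norm (cmod_ge0 z)).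
have [->|z0] := eqVneq z 0; first by rewrite cmod0 invr0 mulr0.
rewrite ler_pdivrMr ?cmod_gt0 // mul1r -(@ler_pXn2r _ 2) ?nnegrE ?cmod_ge0 //.
by rewrite sqr_cmod real_normK ?num_real // /dot -!expr2 lerDl sqr_ge0.
Qed.

Lemma cmod_cos_carg z : cmod z * cos (carg z) = complex.Re z.
Proof.
rewrite /carg; case: eqVneq => [->|z0]; first by rewrite cmod0 mul0r.
rewrite (fun_if cos) cosN if_same acosK ?in_itv /= ?Re_div_cmod_bounds //.
by rewrite mulrC divfK // gt_eqF ?cmod_gt0.
Qed.

Lemma cmod_sin_carg z : cmod z * sin (carg z) = complex.Im z.
Proof.
rewrite /carg; case: eqVneq => [->|z0]; first by rewrite cmod0 mul0r.
have sinE : cmod z * sin (acos (complex.Re z / cmod z)) = `|complex.Im z|.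
  rewrite sin_acos ?Re_div_cmod_bounds // -[X in X * _](ger0_norm (cmod_ge0 z)).
  rewrite -sqrtr_sqr -sqrtrM ?sqr_ge0 // mulrBr mulr1 -exprMn mulrC.
  rewrite divfK ?gt_eqF ?cmod_gt0 // sqr_cmod /dot -!expr2 addrAC subrr add0r.
  exact: sqrtr_sqr.
case: leP => im; rewrite ?sinN ?mulrN sinE; first exact: ger0_norm.
by rewrite ltr0_norm ?opprK.
Qed.

Lemma dot_polar z w : dot z w = cmod z * cmod w * cos (carg z - carg w).
Proof. by rewrite /dot -!cmod_cos_carg -!cmod_sin_carg cosB; ring. Qed.

Lemma dot_le_cmod z w : dot z w <= cmod z * cmod w.
Proof.
rewrite dot_polar -[leRHS]mulr1 ler_wpM2l ?mulr_ge0 ?cmod_ge0 //.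
exact: cos_le1.
Qed.

Lemma ler_cos : {in `[0, pi] &, {mono @cos R : x y /~ y <= x}}.
Proof. by move=> x y x0pi y0pi; rewrite !leNgt ltr_cos. Qed.

Lemma cos_gt0_lt_pihalf t : 0 <= t < pi / 2 -> 0 < cos t.
Proof.
move=> /andP[t0 t_lt]; apply: cos_gt0_pihalf; rewrite t_lt andbT.
by rewrite (lt_le_trans _ t0) // oppr_lt0 divr_gt0 ?pi_gt0.
Qed.

Lemma sec_ge1 t : 0 <= t < pi / 2 -> 1 <= sec t.
Proof. by move=> /cos_gt0_lt_pihalf cos_t; rewrite invf_ge1 ?cos_le1. Qed.

Lemma sec_le_mul_sec_half t : 0 <= t < pi / 2 -> sec t <= sec t * sec (t / 2).
Proof.
move=> t_bounds; rewrite ler_peMr ?(le_trans ler01) ?sec_ge1 //.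
by case/andP: t_bounds; lra.
Qed.

Lemma dot_ge_of_carg z w t : `|carg z - carg w| <= t -> t <= pi ->
  cos t * (cmod z * cmod w) <= dot z w.
Proof.
move=> zw tpi; rewrite dot_polar mulrC ler_wpM2l ?mulr_ge0 ?cmod_ge0 //.
rewrite -[leRHS]cos_norm ler_cos ?in_itv //= ?normr_ge0 ?(le_trans zw) //.
by rewrite (le_trans (normr_ge0 _) zw).
Qed.

End PlaneVectors.

Section AcuteFamily.
Variables (R : realType) (T : finType) (s : T -> R[i]).
Hypothesis acute : forall i j, 0 <= dot (s i) (s j).
Implicit Types A B : {set T}.

Lemma acute_dot_sum_ge0 A B : 0 <= dot (\sum_(i in A) s i) (\sum_(i in B) s i).
Proof.
rewrite dot_suml sumr_ge0 // => i _.
by rewrite dotC dot_suml sumr_ge0.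
Qed.

Lemma acute_cmod_sum_le A B :
  A \subset B -> cmod (\sum_(i in A) s i) <= cmod (\sum_(i in B) s i).
Proof.
move=> sAB; rewrite ler_cmod [in leRHS](big_setID A) /= (setIidPr sAB) dot_sqrD -addrA.
by rewrite lerDl addr_ge0 ?mulr_ge0 ?acute_dot_sum_ge0.
Qed.

End AcuteFamily.

Section NarrowCone.
Variables (R : realType) (T : finType) (s : T -> R[i]) (c : R).
Hypothesis c_ge0 : 0 <= c.
Hypothesis s_cone : forall i j, c * (cmod (s i) * cmod (s j)) <= dot (s i) (s j).
Implicit Types (J A : {set T}) (k : T).

Lemma cone_acute i j : 0 <= dot (s i) (s j).
Proof. by apply: le_trans (s_cone i j); rewrite !mulr_ge0 ?cmod_ge0. Qed.

Lemma cone_dot_le J k i :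
  {in J, forall j, cmod (s k) <= cmod (s j)} -> 1 <= #|J|%:R * c ->
  dot (s k) (s i) <= dot (\sum_(j in J) s j) (s i).
Proof.
move=> kleJ Jc; apply: le_trans (dot_le_cmod _ _) _; rewrite dot_suml.
apply: le_trans (_ : \sum_(j in J) c * (cmod (s k) * cmod (s i)) <= _).
  rewrite sumr_const -[leRHS]mulr_natl mulrA -[leLHS]mul1r.
  by rewrite ler_wpM2r ?mulr_ge0 ?cmod_ge0.
apply: ler_sum => j jJ; apply: le_trans (s_cone j i).
by rewrite ler_wpM2l // ler_wpM2r ?cmod_ge0 ?kleJ.
Qed.

Lemma cone_cmod_exchange J A k :
  {in J, forall j, cmod (s k) <= cmod (s j)} -> 1 <= #|J|%:R * c ->
  cmod (s k + \sum_(i in A) s i)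
    <= cmod (\sum_(j in J) s j + \sum_(i in A) s i).
Proof.
move=> kleJ Jc; rewrite ler_cmod !dot_sqrD lerD2r lerD //; last first.
  rewrite ler_wpM2l // ![dot _ (\sum_(i in A) _)]dotC !dot_suml.
  by apply: ler_sum => i _; rewrite dotC [leRHS]dotC; apply: cone_dot_le.
apply: le_trans (cone_dot_le k kleJ Jc) _; rewrite [leRHS]dot_suml dot_suml.
by apply: ler_sum => j _; rewrite dotC [leRHS]dotC; apply: cone_dot_le.
Qed.

End NarrowCone.

Section Instance.
Variables (R : realType) (I : opf_instance R).
Local Notation E := (edges I).
Local Notation z := (@impedance R I).
Local Notation s := (@demand R I).
Implicit Types (k j : customer I) (e f : {set node I}) (A J : {set customer I}).

Let treeI : tree E := treeP I.

Definition demand_le : rel (customer I) := fun k j => cmod (s k) <= cmod (s j).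

Definition edge_demand k e : R[i] := if e \in Pk k then s k else 0.

Definition voltage_drop k e : R := \sum_(f in Pk k :&: Pe e) dot (z f) (s k).

Local Notation overloadedC := (overloaded E (@cmod R) edge_demand (@capacity R I)).
Local Notation overloadedV := (overloaded E id voltage_drop (fun=> Vbar I)).

Definition feasibleC : pred {set customer I} :=
  within_budget E (@cmod R) edge_demand (@capacity R I).

Definition feasibleV : pred {set customer I} :=
  within_budget E id voltage_drop (fun=> Vbar I).

Lemma constraintC_indicator A : constraintC (indicator A) = feasibleC A.
Proof.
apply: eq_forallb_in => e _; congr (cmod _ <= _).
rewrite big_mkcond [RHS]big_mkcond; apply: eq_bigr => k _.
by rewrite ffunE /edge_demand; case: ifP => _; case: ifP; rewrite ?mulr1 ?mulr0.
Qed.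

Lemma constraintV_indicator A : constraintV (indicator A) = feasibleV A.
Proof.
apply: eq_forallb_in => e _; congr (_ <= _); rewrite [RHS]big_mkcond.
by apply: eq_bigr => k _; rewrite ffunE; case: ifP; rewrite ?mulr1 ?mulr0.
Qed.

Section Capacity.
Hypothesis theta_bounds : 0 <= theta I < pi / 2.

Let cos_theta_gt0 : 0 < cos (theta I) := cos_gt0_lt_pihalf theta_bounds.

Lemma demand_cone k j :
  cos (theta I) * (cmod (s k) * cmod (s j)) <= dot (s k) (s j).
Proof.
apply: dot_ge_of_carg; first by apply: (bigmax_sup k) => //; apply: (bigmax_sup j).
by have := pi_gt0 R; case/andP: theta_bounds; lra.
Qed.

Lemma edge_demand_cone e k j :
  cos (theta I) * (cmod (edge_demand k e) * cmod (edge_demand j e))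
    <= dot (edge_demand k e) (edge_demand j e).
Proof.
rewrite /edge_demand; case: ifP => _; last by rewrite dot0 cmod0 mul0r mulr0.
case: ifP => _; first exact: demand_cone.
by rewrite dotC dot0 cmod0 !mulr0.
Qed.

Lemma feasibleC_hereditary : hereditary feasibleC.
Proof.
apply: within_budget_hereditary => A B e; apply: acute_cmod_sum_le.
exact: cone_acute (ltW cos_theta_gt0) (edge_demand_cone e).
Qed.

Lemma edge_demand_neq0 k e : edge_demand k e != 0 -> e \in Pk k.
Proof. by rewrite /edge_demand; case: ifP; rewrite ?eqxx. Qed.

Lemma blocks_common_edge J A k : blocks feasibleC J A k -> J != set0 ->
  exists j e, [/\ j \in J, overloadedC (k |: (j |: A)) e, e \in Pk k
    & {in J, forall i, e \in Pk i}].
Proof.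
move=> blocked /set0Pn[j0 j0J].
pose bad := [set e in Pk k | [exists j in J, overloadedC (k |: (j |: A)) e]].
have bad_of j : j \in J -> exists2 e, e \in bad & e \in Pk j.
  move=> jJ; have [e over] := blocks_overloaded blocked jJ.
  have [/edge_demand_neq0 ek /edge_demand_neq0 ej] :=
    blocks_load_neq0 feasibleC_hereditary blocked jJ over.
  by exists e => //; rewrite inE ek; apply/existsP; exists j; rewrite jJ.
have bad0 : bad != set0 by have [e e_bad _] := bad_of j0 j0J; apply/set0Pn; exists e.
have bad_k : bad \subset Pk k by apply/subsetP => e /setIdP[].
have [e /setIdP[ek /existsP[j /andP[jJ over]]] closest] :=
  node_path_closest_edge treeI bad0 bad_k.
exists j, e; split=> // i /bad_of[f /closest ef fi].
exact: subsetP (edge_path_sub_node_path treeI fi) e ef.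
Qed.

Lemma feasibleC_extendible n : sec (theta I) <= n%:R ->
  extendible feasibleC demand_le n.
Proof.
move=> sec_n; apply: extendible_of_blocks => J A k blocked kleJ.
have [->|J0] := eqVneq J set0; first by rewrite cards0.
have [j [e [jJ over ek eJ]]] := blocks_common_edge blocked J0.
have few : #|J :\ j|%:R * cos (theta I) < 1.
  have := blocks_magnitude_lt blocked jJ over; rewrite !ltNge; apply: contra.
  apply: (cone_cmod_exchange (ltW cos_theta_gt0) (edge_demand_cone e)).
  by move=> i /setD1P[_ iJ]; rewrite /edge_demand ek eJ //; apply: kleJ.
rewrite (cardsD1 j) jJ add1n -(ltr_nat R); apply: lt_le_trans sec_n.
by rewrite /sec -[ltRHS]mul1r ltr_pdivlMr.
Qed.

End Capacity.

Section Voltage.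
Hypothesis theta_zs_bounds : 0 <= theta_zs I < pi / 2.

Let cos_theta_zs_gt0 : 0 < cos (theta_zs I) := cos_gt0_lt_pihalf theta_zs_bounds.

Lemma dot_impedance_ge k f : f \in Pk k ->
  cos (theta_zs I) * (cmod (z f) * cmod (s k)) <= dot (z f) (s k).
Proof.
move=> fk; apply: dot_ge_of_carg.
  by rewrite distrC; apply: (bigmax_sup k) => //; apply: (bigmax_sup f).
by have := pi_gt0 R; case/andP: theta_zs_bounds; lra.
Qed.

Lemma dot_impedance_ge0 k f : f \in Pk k -> 0 <= dot (z f) (s k).
Proof.
move/dot_impedance_ge; apply: le_trans.
by rewrite !mulr_ge0 ?cmod_ge0 ?(ltW cos_theta_zs_gt0).
Qed.

Lemma voltage_drop_ge0 k e : 0 <= voltage_drop k e.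
Proof. by apply: sumr_ge0 => f /setIP[fk _]; apply: dot_impedance_ge0. Qed.

Lemma feasibleV_hereditary : hereditary feasibleV.
Proof.
apply: within_budget_hereditary => A B e sAB.
rewrite [leRHS](big_setID A) /= (setIidPr sAB) lerDl sumr_ge0 // => k _.
exact: voltage_drop_ge0.
Qed.

Lemma voltage_drop_neq0 k e :
  voltage_drop k e != 0 -> exists2 f, f \in Pk k & f \in Pe e.
Proof.
rewrite /voltage_drop; have [->|[f /setIP[fk fe]]] := set_0Vmem (Pk k :&: Pe e).
  by rewrite big_set0 eqxx.
by exists f.
Qed.

Lemma voltage_drop_ge k e f : f \in Pk k -> f \in Pe e ->
  cos (theta_zs I) * (cmod (z f) * cmod (s k)) <= voltage_drop k e.
Proof.
move=> fk fe; apply: le_trans (dot_impedance_ge fk) _.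
rewrite /voltage_drop (bigD1 f) /=; last by rewrite inE fk.
by rewrite lerDl sumr_ge0 // => g /andP[/setIP[gk _] _]; apply: dot_impedance_ge0.
Qed.

Lemma impedance_neq0 e : e \in E -> z e != 0.
Proof.
by move=> eE; apply/eqP => z0; have := impedance_Re_gt0 eE; rewrite z0 ltxx.
Qed.

Lemma cmod_impedance_le e f g : e \in E -> f \in Pe e -> g \in Pe e ->
  cmod (z g) <= rho I * cmod (z f).
Proof.
move=> eE fe ge; rewrite -ler_pdivrMr; last first.
  by rewrite cmod_gt0; apply/impedance_neq0; apply: subsetP fe; apply: edge_path_sub.
apply: (bigmax_sup e) => //; apply: (bigmax_sup g) => //; exact: (bigmax_sup f).
Qed.

Lemma voltage_drop_le k e f : e \in E -> f \in Pe e ->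
  voltage_drop k e <= (eta I)%:R * rho I * (cmod (z f) * cmod (s k)).
Proof.
move=> eE fe.
apply: le_trans (_ : \sum_(g in Pk k :&: Pe e) rho I * cmod (z f) * cmod (s k) <= _).
  apply: ler_sum => g /setIP[_ ge]; apply: le_trans (dot_le_cmod _ _) _.
  by rewrite ler_wpM2r ?cmod_ge0 // (cmod_impedance_le eE).
rewrite sumr_const -[leLHS]mulr_natl -!mulrA ler_wpM2r ?mulr_ge0 ?cmod_ge0 //.
  exact: bigmax_ge_id.
rewrite ler_nat (leq_trans (subset_leq_card (subsetIr _ _))) //.
exact: (bigop.bigmax_sup e).
Qed.

Lemma blocks_root_edge J A k : blocks feasibleV J A k ->
  exists2 f, {in J, forall j, f \in Pk j}
    & forall j e, j \in J -> overloadedV (k |: (j |: A)) e -> f \in Pe e.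
Proof.
move=> blocked; have [f fk rf] := root_edge_exists treeI (location_neq_root k).
have shared j e :
    j \in J -> overloadedV (k |: (j |: A)) e -> f \in Pk j /\ f \in Pe e.
  move=> jJ over.
  have [/voltage_drop_neq0[g gk ge] /voltage_drop_neq0[h hj he]] :=
    blocks_load_neq0 feasibleV_hereditary blocked jJ over.
  have [v _ eE] := edge_path_node_path treeI ge; rewrite /Pe eE in ge he *.
  have fv := meeting_paths_root_edge treeI gk ge fk rf.
  by split=> //; apply: (meeting_paths_root_edge treeI he hj fv rf).
exists f => [j jJ|j e jJ /(shared _ _ jJ)[]//].
by have [e /(shared _ _ jJ)[]] := blocks_overloaded blocked jJ.
Qed.

Lemma feasibleV_extendible n : (eta I)%:R * rho I * sec (theta_zs I) <= n%:R ->
  extendible feasibleV demand_le n.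
Proof.
move=> sec_n; apply: extendible_of_blocks => J A k blocked kleJ.
have [->|/set0Pn[j jJ]] := eqVneq J set0; first by rewrite cards0.
have [f fJ fover] := blocks_root_edge blocked.
have [e over] := blocks_overloaded blocked jJ; have fe := fover j e jJ over.
have drop_lt : total_load voltage_drop (J :\ j) e < voltage_drop k e.
  by have := blocks_magnitude_lt blocked jJ over; rewrite /= ltrD2r.
have drop_ge : #|J :\ j|%:R * (cos (theta_zs I) * (cmod (z f) * cmod (s k)))
    <= total_load voltage_drop (J :\ j) e.
  rewrite mulr_natl -sumr_const; apply: ler_sum => i /setD1P[_ iJ].
  apply: le_trans (voltage_drop_ge (fJ i iJ) fe).
  by rewrite ler_wpM2l ?(ltW cos_theta_zs_gt0) // ler_wpM2l ?cmod_ge0 //; apply: kleJ.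
have few : #|J :\ j|%:R * cos (theta_zs I) < (eta I)%:R * rho I.
  have eE : e \in E by case/andP: over.
  have := lt_le_trans (le_lt_trans drop_ge drop_lt) (voltage_drop_le k eE fe).
  rewrite mulrA !ltNge; apply: contra => /ler_wpM2r; apply.
  by rewrite mulr_ge0 ?cmod_ge0.
rewrite (cardsD1 j) jJ add1n -(ltr_nat R); apply: lt_le_trans sec_n.
by rewrite /sec ltr_pdivlMr.
Qed.

End Voltage.

Lemma total_utility_indicator A :
  (forall k, utility k = 1) -> total_utility (indicator A) = #|A|%:R.
Proof.
move=> u1; rewrite /total_utility -sum1_card natr_sum [RHS]big_mkcond.
by apply: eq_bigr => k _; rewrite ffunE u1 mul1r; case: ifP.
Qed.

Lemma greedyE (feas : pred (decision I)) (feasS : pred {set customer I}) o :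
  (forall A, feas (indicator A) = feasS A) ->
  greedy feas o = greedy_extend feasS set0 o.
Proof.
move=> feasE; rewrite /greedy; elim: o set0 => //= k o IH M.
by rewrite feasE IH.
Qed.

Lemma greedy_approximation (feas : pred (decision I))
    (feasS : pred {set customer I}) n o :
  (forall k, utility k = 1) -> greedy_order o ->
  (forall A, feas (indicator A) = feasS A) -> hereditary feasS ->
  (0 < n)%N -> extendible feasS demand_le n ->
  approximation n%:R^-1 feas (indicator (greedy feas o)).
Proof.
move=> u1 [perm_o sort_o] feasE her n_gt0 ext x [].
have [O -> fO _] : exists O, x = indicator O.
  by exists [set k | x k]; apply/ffunP => k; rewrite ffunE inE.
rewrite feasE in fO; rewrite (greedyE _ feasE) feasE; split.
  by apply: greedy_extend_feasible; apply: her fO; apply: sub0set.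
rewrite !total_utility_indicator // ler_pdivrMl ?ltr0n // -natrM ler_nat.
apply: (greedy_card her _ n_gt0 ext) => //; first by move=> k; apply: lexx.
  by rewrite -sorted_pairwise // => j k i; apply: le_trans.
by move=> k _; rewrite (perm_mem perm_o) mem_enum.
Qed.

End Instance.

Lemma floor_succ_truncn (R : archiRealDomainType) (x : R) :
  0 <= x -> (Num.floor x + 1)%:~R = (Num.truncn x).+1%:R :> R.
Proof.
move=> x0; rewrite truncn_floor x0 -addn1 natrD intrD.
by rewrite -[in LHS](gez0_abs (_ : 0 <= Num.floor x)) ?floor_ge0.
Qed.

Theorem theorem3 (R : realType) (I : opf_instance R) (o : seq (customer I))
  (unit_utility : forall k : customer I, utility k = 1)
  (theta_bounds : 0 <= theta I < pi / 2)
  (theta_zs_bounds : 0 <= theta_zs I < pi / 2)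
  (o_sorted : greedy_order o) :
  let a := Num.floor (sec (theta I) * sec (theta I / 2)) in
  let b := Num.floor ((eta I)%:R * rho I * sec (theta_zs I)) in
  [/\ approximation ((a + 1)%:~R^-1) (@constraintC R I) (GreedyAllocC o),
      approximation ((b + 1)%:~R^-1) (@constraintV R I) (GreedyAllocV o)
    & approximation ((b + a + 2)%:~R^-1) (@constraintCV R I) (GreedyAlloc o)].
Proof.
have sec_le := sec_le_mul_sec_half theta_bounds.
set x := sec _ * sec _ in sec_le *; set y := _ * sec _ => a b.
have x_ge0 : 0 <= x := le_trans (le_trans ler01 (sec_ge1 theta_bounds)) sec_le.
have y_ge0 : 0 <= y.
  rewrite /y !mulr_ge0 ?(le_trans ler01 (sec_ge1 theta_zs_bounds)) //.
  exact: bigmax_ge_id.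
have extC : extendible (@feasibleC R I) (@demand_le R I) (Num.truncn x).+1.
  exact/(feasibleC_extendible theta_bounds)/(le_trans sec_le)/ltW/truncnS_gt.
have extV : extendible (@feasibleV R I) (@demand_le R I) (Num.truncn y).+1.
  exact/(feasibleV_extendible theta_zs_bounds)/ltW/truncnS_gt.
have herC := feasibleC_hereditary theta_bounds.
have herV := feasibleV_hereditary theta_zs_bounds.
have -> : (b + a + 2)%:~R = ((Num.truncn x).+1 + (Num.truncn y).+1)%:R :> R.
  by rewrite natrD -!floor_succ_truncn // -intrD; congr (_%:~R); ring.
rewrite !floor_succ_truncn //; split.
- exact: greedy_approximation (@constraintC_indicator R I) herC _ extC.
- exact: greedy_approximation (@constraintV_indicator R I) herV _ extV.
have extCV := extendibleI herC herV extC extV.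
apply: greedy_approximation (hereditaryI herC herV) _ extCV => // A.
by rewrite /constraintCV constraintC_indicator constraintV_indicator.
Qed.
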